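(* Let $D\ge 3$. There are countably infinitely many (up to isomorphism) infinite graphs that are strongly isolated in $(\mathfrak{G}_{\le D},d)$, and hence also in $(\mathfrak{G}^{\infty}_{\le D},d)$.
   Context: Graphs are simple. $\mathfrak{G}_{\le D}$ is the set of connected graphs of maximum degree at most $D$, up to isomorphism; $\mathfrak{G}^{\infty}_{\le D}$ is the subset of infinite ones. For a graph $G$ and $r\ge 0$, $B_r(G,v)$ is the subgraph induced by the vertices at distance at most $r$ from $v$, rooted at $v$, and $\mathfrak{B}_r(G)=\{B_r(G,v): v\in V(G)\}$, a set of rooted graphs up to root-preserving isomorphism (multiplicities ignored). The pseudometric $d$ on $\mathfrak{G}_{\le D}$ is $d(G_1,G_2)=\inf\{2^{-r}: \mathfrak{B}_r(G_1)=\mathfrak{B}_r(G_2)\}$, where equality is as sets of root-preserving isomorphism classes. A point $x$ of a pseudometric space $(X,d)$ is strongly isolated if there is $\varepsilon>0$ such that no $x'\in X$ with $x'\neq x$ satisfies $d(x,x')\le\varepsilon$; for graphs, $x'\ne x$ means non-isomorphic. *)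

(* Defs.v *)
(* MathComp-Analysis; graphs are possibly infinite, on arbitrary vertex types. *)
From mathcomp Require Import all_boot all_order all_algebra.
From mathcomp Require Import all_classical all_reals.

Set Implicit Arguments.
Unset Strict Implicit.
Unset Printing Implicit Defensive.

Import Order.TTheory GRing.Theory Num.Theory.

Local Open Scope classical_set_scope.
Local Open Scope card_scope.
Local Open Scope ring_scope.

Record graph := Graph {
  vertex :> Type;
  adj : rel vertex;
  adj_sym : symmetric adj;
  adj_irr : irreflexive adj }.

Definition graph_iso (G H : graph) : Prop :=
  exists f : G -> H, bijective f /\ forall x y, adj (f x) (f y) = adj x y.

Definition iso_class (G : graph) : set graph := [set H | graph_iso G H].

(* The graph distance from v to w is at most r: the walk v :: p has size p
   edges. *)
Definition dist_le (G : graph) (r : nat) (v w : G) : Prop :=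
  exists p : seq G, [/\ path (@adj G) v p, last v p = w & (size p <= r)%N].

(* The empty graph is not connected. *)
Definition connected_graph (G : graph) : Prop :=
  inhabited G /\ forall v w : G, exists r, dist_le r v w.

Definition max_degree_le (D : nat) (G : graph) : Prop :=
  forall v : G, [set w | adj v w] #<= `I_D.

Definition Gle (D : nat) : set graph :=
  [set G | connected_graph G /\ max_degree_le D G].

Definition infinite_graph : set graph :=
  [set G | infinite_set [set: vertex G]].

Definition Gle_inf (D : nat) : set graph := Gle D `&` infinite_graph.

Record rgraph := RGraph { rg_graph :> graph; root : rg_graph }.

Definition rgraph_iso (G H : rgraph) : Prop :=
  exists f : G -> H,
    [/\ bijective f, forall x y, adj (f x) (f y) = adj x y
      & f (root G) = root H].

Definition rgraph_iso_class (G : rgraph) : set rgraph :=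
  [set H | rgraph_iso G H].

Section InducedSubgraph.
Variables (G : graph) (A : set G).

(* Not the coercion of [A] to a type: its universe lies above that of [graph],
   because it is also used on sets of graphs. *)
Let sub_vertex : Type := {x : G | A x}.

Let sub_adj : rel sub_vertex := fun x y => adj (sval x) (sval y).

Let sub_adj_sym : symmetric sub_adj.
Proof. by move=> x y; exact: adj_sym. Qed.

Let sub_adj_irr : irreflexive sub_adj.
Proof. by move=> x; exact: adj_irr. Qed.

Definition induced : graph := Graph sub_adj_sym sub_adj_irr.

End InducedSubgraph.

Definition ball_set (G : graph) (r : nat) (v : G) : set G :=
  [set w | dist_le r v w].

Lemma ball_center (G : graph) (r : nat) (v : G) : ball_set r v v.
Proof. by exists [::]. Qed.

Definition rball (G : graph) (r : nat) (v : G) : rgraph :=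
  @RGraph (induced (ball_set r v)) (exist _ v (ball_center r v)).

Definition rballs (r : nat) (G : graph) : set (set rgraph) :=
  [set rgraph_iso_class (rball r v) | v in [set: vertex G]].

(* On nonempty graphs the infimum is over a nonempty set (r = 0 always
   qualifies), so no junk value of [inf] is involved. *)
Definition gdist (R : realType) (G1 G2 : graph) : R :=
  inf [set 2 ^- r | r in [set r : nat | rballs r G1 = rballs r G2]].

Definition strongly_isolated (R : realType) (X : set graph) : set graph :=
  [set G | X G /\ exists2 eps : R, 0 < eps &
     ~ exists H, [/\ X H, ~ graph_iso G H & gdist R G H <= eps]].

Definition countably_infinite_up_to_iso (P : set graph) : Prop :=
  iso_class @` P #= [set: nat].

(* Main.v *)
(** The graph G_k is a ray: a path of k vertices leading to an infinite chain
    of five-vertex houses, all oriented the same way. First-order formulas with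
    quantifiers restricted to neighbours are local, so their truth at a vertex is
    read off its ball. Such formulas define the colour of a vertex of G_k: its
    distance to the leaf if it lies on the tail, its position in its house
    otherwise. Hence a connected H with the same balls of large radius inherits
    colours, and around every vertex H looks like G_k with its colours. Neighbours
    of a vertex have distinct colours, so from a vertex of H coloured as the leaf
    there is a unique walk following the colours of the ray. This walk is closed
    under neighbours, hence covers H, and it is injective because it can be
    retraced uniquely to the leaf, whose colour does not recur on the ray. So H is
    isomorphic to G_k, and every G_k with k > 0 is strongly isolated.

    Conversely, a strongly isolated G is determined by a radius r and its set of
    r-balls, a subset of the finite set of balls of radius r and degree at most D. *)
Require Import Defs.
From mathcomp Require Import all_boot all_order all_algebra.
From mathcomp Require Import all_classical all_reals.
From mathcomp Require Import zify.
(* Again, because [rgraph] and [root] are also names of fingraph. *)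
Import Defs.

Set Implicit Arguments.
Unset Strict Implicit.
Unset Printing Implicit Defensive.

Import Order.TTheory GRing.Theory Num.Theory.

Local Open Scope classical_set_scope.

(** * Distances and isomorphisms *)

Lemma dist_le0 (G : graph) (v w : G) : dist_le 0 v w <-> w = v.
Proof.
by split=> [[[|u p] [//= _ <- _]] | ->] //; exact: ball_center.
Qed.

Lemma dist_leS (G : graph) r (v w : G) :
  dist_le r.+1 v w <-> w = v \/ exists2 u, adj v u & dist_le r u w.
Proof.
split.
  move=> [[|u p] [/= vp lp sp]]; first by left.
  by case/andP: vp => vu up; right; exists u => //; exists p.
move=> [->|[u vu [p [pp lp sp]]]]; first exact: ball_center.
by exists (u :: p); split => //=; rewrite vu.
Qed.

Lemma dist_le_rcons (G : graph) r (v u w : G) :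
  dist_le r v u -> adj u w -> dist_le r.+1 v w.
Proof.
move=> [p [pp lp sp]] uw; exists (rcons p w).
by rewrite rcons_path last_rcons size_rcons pp lp uw.
Qed.

Lemma dist_le_rconsP (G : graph) r (v w : G) :
  dist_le r.+1 v w -> w = v \/ exists2 u, dist_le r v u & adj u w.
Proof.
move=> [p]; case/lastP: p => [|p u] [pp lp sp]; first by left.
move: pp lp sp; rewrite rcons_path last_rcons size_rcons => /andP[pp lu] <- sp.
by right; exists (last v p) => //; exists p.
Qed.

Lemma dist_le_mono (G : graph) r s (v w : G) :
  (r <= s)%N -> dist_le r v w -> dist_le s v w.
Proof. by move=> rs [p [pp lp sp]]; exists p; split=> //; exact: leq_trans rs. Qed.

Lemma graph_iso_refl (G : graph) : graph_iso G G.
Proof. by exists id; split=> //; exists id. Qed.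

Lemma graph_iso_sym (G H : graph) : graph_iso G H -> graph_iso H G.
Proof.
move=> [f [[g fg gf] fA]]; exists g; split; first by exists f.
by move=> x y; rewrite -{2}[x]gf -{2}[y]gf fA.
Qed.

Lemma graph_iso_trans (G H K : graph) :
  graph_iso G H -> graph_iso H K -> graph_iso G K.
Proof.
move=> [f [bf fA]] [g [bg gA]]; exists (g \o f).
by split=> [|x y /=]; [exact: bij_comp | rewrite gA fA].
Qed.

Lemma iso_classP (G H : graph) : iso_class G = iso_class H <-> graph_iso G H.
Proof.
split=> [e|GH].
  have : iso_class H H by exact: graph_iso_refl.
  by rewrite -e.
apply/seteqP; split=> K; apply: graph_iso_trans => //.
exact: graph_iso_sym.
Qed.

Lemma rgraph_iso_class_eq (B C : rgraph) :
  rgraph_iso_class B = rgraph_iso_class C -> rgraph_iso B C.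
Proof.
move=> e; have : rgraph_iso_class C C by exists id; split=> //; exists id.
by rewrite -e.
Qed.

(** * Charts and local formulas *)

(* A local isomorphism on the ball of radius [r]; its values elsewhere are
   irrelevant. *)
Definition chart (r : nat) (G H : graph) (v : G) (psi : G -> H) : Prop :=
  [/\ {in ball_set r v &, injective psi},
      {in ball_set r v &, forall x y, adj (psi x) (psi y) = adj x y}
    & forall s x h, (s < r)%N -> dist_le s v x -> adj (psi x) h ->
        exists2 y, adj x y & psi y = h].

Lemma rball_iso_chart r (G H : graph) (v : G) (h : H) :
  rgraph_iso (rball r v) (rball r h) ->
  exists2 psi : G -> H, chart r v psi & psi v = h.
Proof.
move=> [f [[g fg gf] fA fv]].
pose psi x := if pselect (ball_set r v x) is left b
  then sval (f (exist _ x b)) else h.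
have psiE x (b : ball_set r v x) : psi x = sval (f (exist _ x b)).
  by rewrite /psi; case: pselect => // b'; rewrite (Prop_irrelevance b b').
have psiv : psi v = h by rewrite (psiE _ (ball_center r v)) [f _]fv.
have psiA : {in ball_set r v &, forall x y, adj (psi x) (psi y) = adj x y}.
  move=> x y /set_mem xb /set_mem yb; rewrite (psiE _ xb) (psiE _ yb).
  exact: (fA (exist _ x xb) (exist _ y yb)).
(* Distances are carried over so that a neighbour of [psi x] is known to lie in the ball of [h], the
   domain of [g]. *)
have psi_dist s x : (s <= r)%N -> dist_le s v x -> dist_le s h (psi x).
  elim: s x => [|s IHs] x sr; first by move=> /dist_le0 ->; apply/dist_le0.
  move=> vx; case/dist_le_rconsP: (vx) => [->|[u vu ux]].
    by rewrite psiv; exact: ball_center.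
  apply: (@dist_le_rcons _ _ _ (psi u)); first exact: IHs (ltnW sr) vu.
  rewrite psiA //; apply/mem_set; apply: dist_le_mono; [|exact: vu| |exact: vx] => //.
  exact: ltnW.
exists psi => //; split=> //.
  move=> x y /set_mem xb /set_mem yb; rewrite (psiE _ xb) (psiE _ yb).
  by move=> /eq_sig_hprop e; have /(can_inj fg)[] := e (fun=> @Prop_irrelevance _).
move=> s x h' sr vx xh'.
have hb : ball_set r h h'.
  apply: (dist_le_mono sr).
  by apply: dist_le_rcons xh'; exact: psi_dist (ltnW sr) vx.
have xb : ball_set r v x by exact: dist_le_mono (ltnW sr) vx.
case ey : (g (exist _ h' hb)) => [y yb].
have psiy : psi y = h' by rewrite (psiE _ yb) -ey gf.
exists y => //; rewrite -psiA ?psiy //; exact/mem_set.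
Qed.

Lemma rballs_chart r (G H : graph) (h : H) :
  rballs r G = rballs r H ->
  exists (v : G) (psi : G -> H), chart r v psi /\ psi v = h.
Proof.
move=> e; have : rballs r H (rgraph_iso_class (rball r h)) by exists h.
rewrite -e => -[v _ ev]; have [psi ch ph] := rball_iso_chart (rgraph_iso_class_eq ev).
by exists v, psi.
Qed.

Inductive formula :=
  | FAdj of nat & nat
  | FEq of nat & nat
  | FNot of formula
  | FAnd of formula & formula
  | FEx of nat & formula.

Definition push {T : Type} (x : T) (e : nat -> T) : nat -> T :=
  fun n => if n is m.+1 then e m else x.

(* De Bruijn indices: [FEx i p] binds a neighbour of variable [i] as variable
   0. *)
Fixpoint sat (G : graph) (p : formula) (e : nat -> G) : Prop :=
  match p with
  | FAdj i j => adj (e i) (e j)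
  | FEq i j => e i = e j
  | FNot p => ~ sat p e
  | FAnd p q => sat p e /\ sat q e
  | FEx i p => exists2 y, adj (e i) y & sat p (push y e)
  end.

Fixpoint rank (p : formula) : nat :=
  match p with
  | FAdj _ _ | FEq _ _ => 0
  | FNot p => rank p
  | FAnd p q => maxn (rank p) (rank q)
  | FEx _ p => (rank p).+1
  end.

Lemma comp_push (T U : Type) (f : T -> U) x e :
  f \o push x e = push (f x) (f \o e).
Proof. by apply/funext => -[]. Qed.

(** Each quantifier moves at most one step further from [v], so all variables stay within
    [s + rank p], where [psi] preserves atoms; the last clause of [chart] lifts witnesses back from
    [H]. *)
Lemma chart_sat r (G H : graph) (v : G) (psi : G -> H) p s e :
  chart r v psi -> (forall i, dist_le s v (e i)) -> (s + rank p <= r)%N ->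
  sat p e <-> sat p (psi \o e).
Proof.
move=> [inj hA onto]; elim: p s e => [i j|i j|p IHp|p IHp q IHq|i p IHp] s e vs /= sr.
- by rewrite hA // inE; apply: dist_le_mono (vs _); rewrite addn0 in sr.
- split=> [-> //|]; apply: inj; rewrite inE; apply: dist_le_mono (vs _).
    by rewrite addn0 in sr.
  by rewrite addn0 in sr.
- by have := IHp s e vs sr; tauto.
- have := IHp s e vs; have := IHq s e vs.
  have [-> ->] : (s + rank p <= r)%N /\ (s + rank q <= r)%N by lia.
  by move=> /(_ isT) + /(_ isT); tauto.
- have sr' : (s < r)%N by lia.
  have vs' y : adj (e i) y -> forall j, dist_le s.+1 v (push y e j).
    move=> iy [|j] /=; first exact: dist_le_rcons (vs i) iy.
    exact: dist_le_mono (leqnSn s) (vs j).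
  have {}IHp y (iy : adj (e i) y) : sat p (push y e) <-> sat p (push (psi y) (psi \o e)).
    by rewrite -comp_push; apply: (IHp s.+1); [exact: vs' | lia].
  split=> [[y iy py]|[h ih ph]].
    exists (psi y); last exact/IHp.
    rewrite hA // inE; last exact: (dist_le_mono sr' (vs' _ iy 0)).
    exact: dist_le_mono (ltnW sr') (vs i).
  have [y iy yh] := onto s (e i) h sr' (vs i) ih.
  by exists y => //; apply/IHp => //; rewrite yh.
Qed.

(** * Rays of houses *)

(** The two chords of a house: 0-2 closes the triangle and 1-4 the square. The guard [k <= n] keeps
    truncated subtraction from giving residue 0 on the tail. *)
Definition chord (k n m : nat) : bool :=
  (k <= n)%N && [|| ((n - k) %% 5 == 0)%N && (m == n.+2)
                  | ((n - k) %% 5 == 1)%N && (m == n.+3)].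

Definition house_adj (k : nat) : rel nat :=
  fun n m => [|| m == n.+1, n == m.+1, chord k n m | chord k m n].

Lemma house_adj_sym k : symmetric (house_adj k).
Proof. by move=> n m; rewrite /house_adj orbCA [chord k n m || _]orbC. Qed.

Lemma house_adj_irr k : irreflexive (house_adj k).
Proof. by move=> n; rewrite /house_adj /chord; lia. Qed.

(* A path 0, ..., k - 1 followed by an infinite chain of houses: the block
   k + 5q, ..., k + 5q + 4 is a triangle (the first three vertices) on top of a
   square (the last four), entered at the top of the roof and left at a corner
   of the floor. *)
Definition house_chain (k : nat) : graph :=
  Graph (house_adj_sym k) (house_adj_irr k).

Definition color (k n : nat) : nat :=
  if (n < k)%N then n else (k + (n - k) %% 5)%N.

Lemma colorS k n :
  color k n.+1 = if color k n == (k + 4)%N then k else (color k n).+1.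
Proof.
rewrite /color; case: ltnP => kn; first by rewrite ltnW // ifF //; apply/eqP; lia.
have [<-|kn'] : n.+1 = k \/ (k <= n)%N by lia.
  by rewrite ltnSn subnn; case: eqP; lia.
rewrite ltnNge kn' /= subSn //; move: (n - k)%N => d; case: eqP; lia.
Qed.

Lemma color0 k : color k 0 = 0%N.
Proof. by rewrite /color; case: k. Qed.

Lemma color_lt k n : (0 < k)%N -> (color k n < k + 5)%N.
Proof. by rewrite /color; case: (ltnP n k); lia. Qed.

Lemma color_tail k n : (color k n < k)%N = (n < k)%N.
Proof. by rewrite /color; case: (ltnP n k); lia. Qed.

(** Backward chords are also read off the colour of [n], by [colorS], so adjacency depends on that
    colour and the offset to [m] alone. *)
Lemma house_adjE k n m : house_adj k n m =
  [|| m == n.+1, n == m.+1,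
      (color k n == k) && (m == n.+2), (color k n == k.+1) && (m == n.+3),
      (color k n == k.+2) && (n == m.+2) | (color k n == k.+4) && (n == m.+3)].
Proof.
have chordE x y : chord k x y =
    (color k x == k) && (y == x.+2) || (color k x == k.+1) && (y == x.+3).
  rewrite /chord /color; case: (ltnP x k) => kx; first by lia.
  by move: ((x - k) %% 5)%N => d; lia.
rewrite /house_adj !chordE.
have [->|] := eqVneq n m.+2; first by rewrite !colorS; do 2 case: ifP; lia.
have [->|] := eqVneq n m.+3; first by rewrite !colorS; do 3 case: ifP; lia.
lia.
Qed.

(* The successor of colours as a relation, so that linear arithmetic can chain
   several steps without case analysis on [colorS]. *)
Definition next_color (k c d : nat) : Prop :=
  (c = k + 4 /\ d = k \/ c <> k + 4 /\ d = c.+1)%N.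

Lemma color_next k n : next_color k (color k n) (color k n.+1).
Proof. by rewrite /next_color colorS; case: eqP; lia. Qed.

(** With the colours of both ends listed for each kind of edge, closed walks reduce to linear
    arithmetic on offsets and colours. *)
Lemma house_adj_color k n m : house_adj k n m ->
     m = n.+1 /\ next_color k (color k n) (color k m)
  \/ n = m.+1 /\ next_color k (color k m) (color k n)
  \/ m = n.+2 /\ color k n = k /\ color k m = k.+2
  \/ m = n.+3 /\ color k n = k.+1 /\ color k m = k.+4
  \/ n = m.+2 /\ color k n = k.+2 /\ color k m = k
  \/ n = m.+3 /\ color k n = k.+4 /\ color k m = k.+1.
Proof.
rewrite house_adjE.
case/or4P => [/eqP->|/eqP->|/andP[/eqP c /eqP ->]|].
- by left; split=> //; exact: color_next.
- by right; left; split=> //; exact: color_next.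
- have := color_next k n; have := color_next k n.+1; rewrite /next_color; lia.
case/or3P => /andP[/eqP c /eqP e]; subst.
- have := color_next k n; have := color_next k n.+1; have := color_next k n.+2.
  by rewrite /next_color; lia.
- have := color_next k m; have := color_next k m.+1; rewrite /next_color; lia.
- have := color_next k m; have := color_next k m.+1; have := color_next k m.+2.
  by rewrite /next_color; lia.
Qed.

(** Each step back lowers the colour by one, and a positive position in a house excludes vertex 0,
    whose colour is 0. *)
Lemma block_start k n i : (i < 5)%N -> color k n = (k + i)%N ->
  exists m, n = (m + i)%N /\ color k m = k /\ color k m.+1 = k.+1 /\
    color k m.+2 = k.+2 /\ color k m.+3 = k.+3 /\ color k m.+4 = k.+4.
Proof.
elim: i n => [|i IHi] n i5 cn.
  exists n; rewrite addn0 in cn *; have := color_next k n; have := color_next k n.+1.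
  have := color_next k n.+2; have := color_next k n.+3; rewrite /next_color; lia.
case: n cn => [|n] cn; first by rewrite color0 in cn; lia.
have [|m] := IHi n (ltnW i5).
  by have := color_next k n; rewrite /next_color; lia.
by exists m; lia.
Qed.

Lemma triangleP k n :
  (exists2 y, house_adj k n y & exists2 z, house_adj k n z & house_adj k z y) <->
  (k <= color k n < k + 3)%N.
Proof.
split=> [[y /house_adj_color ny [z /house_adj_color nz /house_adj_color zy]]|].
  by move: ny nz zy; rewrite /next_color; lia.
move=> kn; have [||m [nm cm]] := @block_start k n (color k n - k); try lia.
have : (n = m \/ n = m.+1 \/ n = m.+2) by lia.
case=> [->|[->|->]].
- by exists m.+1; last exists m.+2; rewrite house_adjE; lia.
- by exists m; last exists m.+2; rewrite house_adjE; lia.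
- by exists m; last exists m.+1; rewrite house_adjE; lia.
Qed.

Lemma squareP k n : (0 < k)%N ->
  (exists2 y, house_adj k n y & exists2 w, house_adj k n w &
     exists2 z, house_adj k y z & house_adj k z w /\ y <> w /\ n <> z) <->
  (k < color k n)%N.
Proof.
move=> k0; split.
  move=> [y /house_adj_color ny [w /house_adj_color nw [z /house_adj_color yz]]].
  move=> [/house_adj_color zw [yw nz]].
  by move: ny nw yz zw yw nz; rewrite /next_color; case=> [|[|[|[|[]]]]] []; lia.
move=> kn; have n5 := color_lt n k0.
have [||m [nm cm]] := @block_start k n (color k n - k); try lia.
have : (n = m.+1 \/ n = m.+2 \/ n = m.+3 \/ n = m.+4) by lia.
(* The first two witnesses are the neighbours on the square, the third is the opposite corner. *)
case=> [->|[->|[->|->]]].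
- by exists m.+2; last (exists m.+4; last exists m.+3);
    rewrite ?house_adjE; repeat split; rewrite ?house_adjE; lia.
- by exists m.+1; last (exists m.+3; last exists m.+4);
    rewrite ?house_adjE; repeat split; rewrite ?house_adjE; lia.
- by exists m.+2; last (exists m.+4; last exists m.+1);
    rewrite ?house_adjE; repeat split; rewrite ?house_adjE; lia.
- by exists m.+1; last (exists m.+3; last exists m.+2);
    rewrite ?house_adjE; repeat split; rewrite ?house_adjE; lia.
Qed.

(* In every house the triangle is {0, 1, 2} and the only square is {1, 2, 3, 4};
   4 differs from 3 by having a 0 (of the next house) as neighbour, and 2 from 1
   by having a 3. *)
Definition FTriangle := FEx 0 (FEx 1 (FAdj 0 1)).

(** In the innermost scope the variables 3, 2, 1, 0 are [n], [y], [w], [z] of [squareP]. *)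
Definition FSquare :=
  FEx 0 (FEx 1 (FEx 1 (FAnd (FAdj 0 1) (FAnd (FNot (FEq 2 1)) (FNot (FEq 3 0)))))).

(** Degree one, which for positive [k] singles out vertex 0 of the chain. *)
Definition FLeaf := FEx 0 (FNot (FEx 1 (FNot (FEq 0 1)))).

(** Distance at most [j] to a leaf; the disjunction is expressed by negation and conjunction. *)
Fixpoint FNear (j : nat) : formula :=
  if j is i.+1 then FNot (FAnd (FNot (FNear i)) (FNot (FEx 0 (FNear i))))
  else FLeaf.

Definition FTail (j : nat) : formula :=
  if j is i.+1 then FAnd (FNear j) (FNot (FNear i)) else FLeaf.

Definition FHouse0 := FAnd FTriangle (FNot FSquare).
Definition FHouse3 := FAnd FSquare (FAnd (FNot FTriangle) (FNot (FEx 0 FHouse0))).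

Definition FHouse (i : nat) : formula :=
  match i with
  | 0 => FHouse0
  | 1 => FAnd FTriangle (FAnd FSquare (FNot (FEx 0 FHouse3)))
  | 2 => FAnd FTriangle (FAnd FSquare (FEx 0 FHouse3))
  | 3 => FHouse3
  | _ => FAnd FSquare (FAnd (FNot FTriangle) (FEx 0 FHouse0))
  end.

Definition FColor (k c : nat) : formula :=
  if (c < k)%N then FTail c else FHouse (c - k).

Lemma rank_FColor k c : (c < k + 5)%N -> (rank (FColor k c) <= k + 5)%N.
Proof.
have rN j : rank (FNear j) = j.+2 by elim: j => //= i ->; lia.
rewrite /FColor; case: (ltnP c k) => [|_ _]; last first.
  by case: (c - k)%N => [|[|[|[|?]]]] /=; lia.
by case: c => [|c]; rewrite /FTail /= ?rN; lia.
Qed.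

(** * Correctness of the formulas for colours *)

Section Definability.
Variables (k : nat) (k0 : (0 < k)%N).
Implicit Type e : nat -> house_chain k.

Lemma sat_triangle e : sat FTriangle e <-> (k <= color k (e 0) < k + 3)%N.
Proof. exact: triangleP. Qed.

Lemma sat_square e : sat FSquare e <-> (k < color k (e 0))%N.
Proof. exact: squareP. Qed.

Lemma sat_leaf e : sat FLeaf e <-> e 0 = 0%N :> nat.
Proof.
suff: forall n : nat, (exists2 y, house_adj k n y &
    ~ exists2 z, house_adj k n z & ~ (z = y)) <-> n = 0%N by exact.
move=> n; split=> [[y _ ny]|->].
  case: n ny => // n ny; exfalso; apply: ny.
  (* The vertex [n.+1] has both neighbours [n] and [n.+2], and one of them differs from [y]. *)
  have [->|yn] := eqVneq y n; first by exists n.+2; rewrite ?house_adjE; lia.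
  by exists n; rewrite ?house_adjE; lia.
exists 1%N; first by rewrite house_adjE; lia.
by case=> z /house_adj_color; rewrite color0; lia.
Qed.

Lemma sat_near_le j e : (e 0 <= j)%N -> sat (FNear j) e.
Proof.
elim: j e => [|j IHj] e ej; first by apply/sat_leaf; lia.
move=> [nj]; apply; exists (e 0).-1; last by apply: IHj => /=; lia.
rewrite /= house_adjE; case: (posnP (e 0)) => [e0|]; last by lia.
by case: nj; apply: IHj; lia.
Qed.

(** Below [k] there are no chords, so an edge changes the index by one. Past the tail chords shorten
    the way to the leaf, hence the bound on [j]. *)
Lemma sat_near j e : (j < k)%N -> sat (FNear j) e <-> (e 0 <= j)%N.
Proof.
move=> jk; split; last exact: sat_near_le.
elim: j e jk => [|j IHj] e jk; first by move/sat_leaf->.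
move=> /not_andP[/contrapT /IHj|/contrapT [y /house_adj_color ny /IHj]]; first by lia.
move=> /(_ (ltnW jk)) /= yj; move: ny; have := color_tail k y; rewrite /next_color; lia.
Qed.

Lemma sat_tail j e : (j < k)%N -> sat (FTail j) e <-> (e 0 = j :> nat).
Proof.
case: j => [_|j jk]; first exact: sat_leaf.
change (sat (FNear j.+1) e /\ ~ sat (FNear j) e <-> e 0 = j.+1 :> nat).
rewrite (propext (sat_near e jk)) (propext (sat_near e (ltnW jk))); lia.
Qed.

Lemma sat_house0 e : sat FHouse0 e <-> color k (e 0) = k.
Proof.
change (sat FTriangle e /\ ~ sat FSquare e <-> color k (e 0) = k).
rewrite (propext (sat_triangle e)) (propext (sat_square e)).
lia.
Qed.

Lemma sat_FEx0 p c e : (forall e', sat p e' <-> color k (e' 0) = c) ->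
  sat (FEx 0 p) e <-> exists2 m, house_adj k (e 0) m & color k m = c.
Proof. by move=> pc; split=> -[m em cm]; exists m => //; apply/(pc (push m e)). Qed.

Lemma ex_house0 n : (k + 3 <= color k n)%N ->
  (exists2 m, house_adj k n m & color k m = k) <-> color k n = (k + 4)%N.
Proof.
move=> n3; split=> [[m /house_adj_color]|n4]; first by rewrite /next_color; lia.
by exists n.+1; [rewrite house_adjE; lia|have := color_next k n; rewrite /next_color; lia].
Qed.

Lemma sat_house3 e : sat FHouse3 e <-> color k (e 0) = (k + 3)%N.
Proof.
change (sat FSquare e /\ ~ sat FTriangle e /\ ~ sat (FEx 0 FHouse0) e <-> color k (e 0) = k + 3)%N.
rewrite (propext (sat_triangle e)).
rewrite (propext (sat_square e)) (propext (sat_FEx0 e sat_house0)).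
have n5 := color_lt (e 0) k0; have := @ex_house0 (e 0).
case: (leqP (k + 3)%N (color k (e 0))) => [n3 /(_ isT)/propext->|n3 _]; first by lia.
by split=> [|e3]; lia.
Qed.

Lemma ex_house3 n : (k < color k n < k + 3)%N ->
  (exists2 m, house_adj k n m & color k m = (k + 3)%N) <-> color k n = (k + 2)%N.
Proof.
move=> n3; split=> [[m /house_adj_color]|n4]; first by rewrite /next_color; lia.
by exists n.+1; [rewrite house_adjE; lia|have := color_next k n; rewrite /next_color; lia].
Qed.

Lemma sat_house i e : (i < 5)%N -> sat (FHouse i) e <-> color k (e 0) = (k + i)%N.
Proof.
have n5 := color_lt (e 0) k0.
have h3 : (k < color k (e 0) < k + 3)%N ->
    sat (FEx 0 FHouse3) e <-> color k (e 0) = (k + 2)%N.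
  by rewrite (propext (sat_FEx0 e sat_house3)); exact: ex_house3.
have h0 : (k + 3 <= color k (e 0))%N ->
    sat (FEx 0 FHouse0) e <-> color k (e 0) = (k + 4)%N.
  by rewrite (propext (sat_FEx0 e sat_house0)); exact: ex_house0.
have T := sat_triangle e; have S := sat_square e.
case: i => [|[|[|[|[|//]]]]] _.
- by rewrite addn0; exact: sat_house0.
- change (sat FTriangle e /\ sat FSquare e /\ ~ sat (FEx 0 FHouse3) e <->
    color k (e 0) = k + 1)%N.
  split=> [[/T t [/S s]]|c]; first by rewrite (propext (h3 _)); lia.
  by rewrite (propext T) (propext S) (propext (h3 _)); lia.
- change (sat FTriangle e /\ sat FSquare e /\ sat (FEx 0 FHouse3) e <->
    color k (e 0) = k + 2)%N.
  split=> [[/T t [/S s]]|c]; first by rewrite (propext (h3 _)); lia.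
  by rewrite (propext T) (propext S) (propext (h3 _)); lia.
- exact: sat_house3.
- change (sat FSquare e /\ ~ sat FTriangle e /\ sat (FEx 0 FHouse0) e <->
    color k (e 0) = k + 4)%N.
  split=> [[/S s [nT /h0]]|c]; first by apply; move: nT; rewrite (propext T); lia.
  by rewrite (propext T) (propext S) (propext (h0 _)); lia.
Qed.

Lemma sat_FColor c e : (c < k + 5)%N -> sat (FColor k c) e <-> color k (e 0) = c.
Proof.
move=> ck; rewrite /FColor; have n5 := color_lt (e 0) k0.
have := color_tail k (e 0); case: (ltnP c k) => kc nk; last first.
  have := sat_house e (_ : c - k < 5)%N => ->; lia.
rewrite (propext (sat_tail e kc)).
by move: nk n5; rewrite /color; case: (ltnP (e 0) k); lia.
Qed.
End Definability.

(** * Rigidity of rays of houses *)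

Lemma adj_succ k n : house_adj k n n.+1.
Proof. by rewrite house_adjE eqxx. Qed.

Lemma dist_add k (v : house_chain k) (j : nat) : dist_le j v (v + j)%N.
Proof.
elim: j => [|j IHj]; first by rewrite addn0; exact: ball_center.
by rewrite addnS; apply: dist_le_rcons IHj _; exact: adj_succ.
Qed.

(** Chords and backward edges never join a colour to its successor. Hence a vertex has at most one
    neighbour of the next colour, which makes walks along colours unique. *)
Lemma adj_color_succ k v y n : house_adj k v y ->
  color k v = color k n -> color k y = color k n.+1 -> y = v.+1.
Proof.
move=> /house_adj_color; have := color_next k n; rewrite /next_color; lia.
Qed.

Lemma adj_color_pred k v y n : house_adj k v y ->
  color k v = color k n.+1 -> color k y = color k n -> v = y.+1.
Proof. by rewrite house_adj_sym => vy cv cy; exact: adj_color_succ vy cy cv. Qed.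

Section Rigidity.
Variables (k : nat) (H : graph) (r : nat).
Hypotheses (k0 : (0 < k)%N) (rk : (k + 8 <= r)%N) (Hc : connected_graph H).
Hypothesis GH : rballs r (house_chain k) = rballs r H.

(** Three is the longest span of an edge along the ray. Colour formulas have rank at most [k + 5],
    so evaluating them up to distance 3 takes radius [k + 8]. *)
Definition colored_chart (hcol : H -> nat) (v : house_chain k) psi :=
  chart r v psi /\ forall y, dist_le 3 v y -> hcol (psi y) = color k y.

(** The colour of [h] is that of the centre of a chart chosen at [h]. Any chart reaching [h] within
    distance 3 agrees, because both preserve the truth of [FColor]. *)
Lemma colored_charts : exists hcol : H -> nat,
  (forall h, exists (v : house_chain k) (psi : house_chain k -> H),
     colored_chart hcol v psi /\ psi v = h) /\ (exists h, hcol h = 0%N).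
Proof.
have /choice[vh /choice[ph chP]] := fun h : H => rballs_chart h GH.
have satH (v : house_chain k) (psi : house_chain k -> H) y c :
    chart r v psi -> dist_le 3 v y -> (c < k + 5)%N ->
    sat (FColor k c) (fun=> psi y) <-> color k y = c.
  move=> ch vy ck; rewrite -(sat_FColor k0 (fun=> y) ck).
  apply: iff_sym; apply: (@chart_sat r _ _ v psi _ 3 (fun=> y)) => //.
  by have := rank_FColor ck; lia.
have hcolE (v : house_chain k) psi y : chart r v psi -> dist_le 3 v y ->
    color k (vh (psi y)) = color k y.
  move=> ch vy; have [ch' ph_y] := chP (psi y).
  apply/(satH _ _ _ _ ch'); [exact: ball_center | exact: color_lt |].
  by rewrite ph_y; apply/(satH _ _ _ _ ch) => //; exact: color_lt.
exists (fun h => color k (vh h)); split=> [h|].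
  have [ch ph_h] := chP h; exists (vh h), (ph h); split=> //; split=> // y vy.
  exact: hcolE ch vy.
(* The ball around the leaf 0 also occurs in [H] and provides a vertex of colour 0. *)
have : rballs r (house_chain k) (rgraph_iso_class (@rball (house_chain k) r 0%N)) by exists 0%N.
rewrite GH => -[h _ /esym /rgraph_iso_class_eq /rball_iso_chart[psi ch _]].
by exists (psi 0%N); rewrite (hcolE _ _ _ ch) ?color0 //; exact: ball_center.
Qed.

Lemma dist_le_edge (G : graph) s (v x y : G) : (s < 3)%N ->
  dist_le s v x -> adj x y -> dist_le 3 v y.
Proof. by move=> s3 vx xy; apply: (dist_le_mono s3); exact: dist_le_rcons vx xy. Qed.

Variables (hcol : H -> nat) (f : nat -> H).
Hypothesis charts : forall h, exists (v : house_chain k) (psi : house_chain k -> H),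
  colored_chart hcol v psi /\ psi v = h.
Hypotheses (f_col : forall n, hcol (f n) = color k n)
  (f_adj : forall n, adj (f n) (f n.+1)).

Section Chart.
Variables (v : house_chain k) (psi : house_chain k -> H).
Hypothesis ch : colored_chart hcol v psi.

Lemma chart_color s (x n : nat) : (s <= 3)%N -> dist_le s v x -> psi x = f n ->
  color k x = color k n.
Proof. by case: ch => _ hc s3 vx e; rewrite -(f_col n) -e hc //; exact: dist_le_mono s3 vx. Qed.

(** The next vertex of the walk lifts to a neighbour of [x] of the next colour, and [adj_color_succ]
    leaves only [x.+1]. *)
Lemma chart_succ s (x n : nat) : (s < 3)%N -> dist_le s v x -> psi x = f n ->
  psi x.+1 = f n.+1.
Proof.
move=> s3 vx xn; have [[_ _ onto] hc] := ch.
have [||y xy yn] := onto s x (f n.+1) _ vx; [by lia | by rewrite xn|].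
have cx := chart_color (ltnW s3) vx xn.
have cy := chart_color (leqnn 3) (dist_le_edge s3 vx xy) yn.
by rewrite -yn (adj_color_succ xy cx cy).
Qed.

Lemma chart_pred s (x n : nat) : (s < 3)%N -> dist_le s v x -> psi x = f n.+1 ->
  exists2 y : nat, x = y.+1 & psi y = f n.
Proof.
move=> s3 vx xn; have [[_ _ onto] hc] := ch.
have [||y xy yn] := onto s x (f n) _ vx; [by lia | by rewrite xn adj_sym|].
have cx := chart_color (ltnW s3) vx xn.
have cy := chart_color (leqnn 3) (dist_le_edge s3 vx xy) yn.
by exists y => //; exact: (adj_color_pred xy cx cy).
Qed.

Lemma chart_add n j : (j <= 3)%N -> psi v = f n -> psi (v + j)%N = f (n + j)%N.
Proof.
move=> + vn; elim: j => [|j IHj] j3; first by rewrite !addn0.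
by rewrite !addnS; apply: chart_succ (dist_add v j) (IHj (ltnW j3)).
Qed.

Lemma chart_sub n j : (j <= 3)%N -> psi v = f (n + j)%N ->
  exists y : nat, [/\ v = (y + j)%N :> nat, dist_le j v y & psi y = f n].
Proof.
elim: j n => [|j IHj] n j3 vn.
  by rewrite addn0 in vn; exists v; split; [rewrite addn0 | exact: ball_center |].
have [|y [vy dy yn]] := IHj n.+1 (ltnW j3); first by rewrite addSnnS.
have [z yz zn] := chart_pred j3 dy yn.
exists z; split=> //; first by rewrite vy yz; lia.
by apply: dist_le_rcons dy _; rewrite yz /= house_adj_sym; exact: adj_succ.
Qed.

End Chart.

Lemma f_adj_homo n m : house_adj k n m -> adj (f n) (f m).
Proof.
wlog nm : n m / (n <= m)%N => [W|] nAm.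
  have [/W|/ltnW mn] := leqP n m; first exact.
  by rewrite adj_sym; apply: W mn _; rewrite house_adj_sym.
have [v [psi [ch vn]]] := charts (f n).
have cv := chart_color ch (leq0n 3) (ball_center 0 v) vn.
(* An edge spans at most three steps, and [v] has the colour of [n], so the edge recurs at [v]. *)
have [j [j3 mj vAj]] : exists j, [/\ (j <= 3)%N, m = (n + j)%N & house_adj k v (v + j)].
  exists (m - n)%N; rewrite house_adjE cv.
  by move/house_adj_color: nAm; rewrite /next_color => nAm; split; lia.
have [[_ psiA _] _] := ch.
rewrite mj -(chart_add ch j3 vn) -vn psiA //; apply/mem_set; first exact: ball_center.
by apply: (dist_le_mono _ (dist_add v j)); lia.
Qed.

Lemma f_adj_onto n h : adj (f n) h -> exists2 m, house_adj k n m & f m = h.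
Proof.
move=> fnh; have [v [psi [ch vn]]] := charts (f n).
have cv := chart_color ch (leq0n 3) (ball_center 0 v) vn.
have [[_ _ onto] _] := ch.
have [||y vy yh] := onto 0 v h _ (ball_center 0 v); [lia|by rewrite vn|].
(* The edge from [v] to [y] is copied to [n], forwards or backwards; for the latter, the colour of
   [n] ensures that [n] is large enough. *)
have [[j [j3 yj nAj]]|[j [m [j3 vj nm nAm]]]] :
  (exists j, [/\ (j <= 3)%N, y = (v + j)%N :> nat & house_adj k n (n + j)]) \/
  (exists j m, [/\ (j <= 3)%N, v = (y + j)%N :> nat, n = (m + j)%N & house_adj k n m]).
- move/house_adj_color: vy => [|[|[|[|[|]]]]].
  + move=> [-> _]; left; exists 1%N; rewrite !addn1; split=> //; exact: adj_succ.
  + move=> [vy cy]; right; exists 1%N, n.-1.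
    suff: (0 < n)%N by move=> n0; rewrite house_adjE; split; lia.
    by rewrite lt0n; apply/eqP => n0; move: cy; rewrite /next_color cv n0 color0; lia.
  + by move=> [-> cy]; left; exists 2%N; rewrite house_adjE; split; lia.
  + by move=> [-> cy]; left; exists 3%N; rewrite house_adjE; split; lia.
  + move=> [vy cy]; right; have [|m [nm _]] := @block_start k n 2 isT; first by lia.
    by exists 2%N, m; rewrite house_adjE; split; lia.
  + move=> [vy cy]; right; have [|m [nm _]] := @block_start k n 4 isT; first by lia.
    by exists 3%N, m.+1; rewrite house_adjE; split; lia.
- by exists (n + j)%N => //; rewrite -yh yj (chart_add ch j3 vn).
- exists m => //; rewrite nm in vn; have [z [vz _ <-]] := chart_sub ch j3 vn.
  by rewrite -yh; congr psi; lia.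
Qed.

(** In the chart at a common vertex both predecessors lift to the predecessor of [v], so equality
    descends along the walk until one index is 0, the only index of colour 0. *)
Lemma f_inj : injective f.
Proof.
elim=> [|n IHn] m.
  have := color_tail k m; rewrite -f_col => + e; rewrite -e f_col color0 k0 => /esym mk.
  by move/(congr1 hcol): e; rewrite !f_col color0 /color mk.
case: m => [|m] e.
  move/(congr1 hcol): e; rewrite !f_col color0; have := color_next k n.
  by rewrite /next_color; lia.
have [v [psi [ch vn]]] := charts (f n.+1).
have [y vy yn] := chart_pred ch (ltn0Sn 2) (ball_center 0 v) vn.
have [z vz zm] := chart_pred ch (ltn0Sn 2) (ball_center 0 v) (etrans vn e).
by congr S; apply: IHn; rewrite -yn -zm; congr psi; lia.
Qed.

Lemma f_surj h : exists n, f n = h.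
Proof.
have [s] := Hc.2 (f 0%N) h; elim: s h => [|s IHs] h.
  by move/dist_le0 ->; exists 0%N.
case/dist_le_rconsP => [->|[u /IHs[n <-] /f_adj_onto[m _ <-]]]; first by exists 0%N.
by exists m.
Qed.

Lemma f_iso : graph_iso (house_chain k) H.
Proof.
exists f; split.
  have /choice[g fg] := f_surj.
  by exists g => // n; apply: f_inj; rewrite fg.
move=> n m; apply/idP/idP => [|/f_adj_homo //].
by move=> /f_adj_onto[p nAp /f_inj <-].
Qed.
End Rigidity.

Lemma house_chain_rigid k r (H : graph) : (0 < k)%N -> (k + 8 <= r)%N ->
  connected_graph H -> rballs r (house_chain k) = rballs r H ->
  graph_iso (house_chain k) H.
Proof.
move=> k0 rk Hc GH; have [hcol [charts [h0 h0c]]] := colored_charts k0 rk GH.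
(* With the colour condition under the existential, choice yields a total step function on pairs,
   and [f] becomes a plain recursion. *)
have succ (p : H * nat) : exists h, hcol p.1 = color k p.2 ->
    adj p.1 h /\ hcol h = color k p.2.+1.
  case: p => h n /=; have [v [psi [[[_ psiA _] hc] <-]]] := charts h.
  exists (psi v.+1).
  have v1 : dist_le 1 v v.+1 by apply: dist_le_rcons (ball_center 0 v) (adj_succ k v).
  rewrite !hc; [|exact: dist_le_mono v1|exact: ball_center] => cv.
  split; last by rewrite !colorS cv.
  rewrite psiA; [exact: adj_succ|exact/mem_set/ball_center|apply/mem_set].
  by apply: dist_le_mono v1; lia.
have [s sP] := choice succ.
pose f := fix f n := if n is m.+1 then s (f m, m) else h0.
have f_col n : hcol (f n) = color k n.
  by elim: n => [|n IHn] /=; [rewrite color0|have [] := sP (f n, n) IHn].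
apply: (f_iso k0 rk Hc charts f_col) => n.
by have [] := sP (f n, n) (f_col n).
Qed.

(** * The chains as pairwise non-isomorphic points of the space *)

Lemma dist_le_sym (G : graph) r (v w : G) : dist_le r v w -> dist_le r w v.
Proof.
elim: r w => [|r IHr] w; first by move/dist_le0 ->; exact: ball_center.
case/dist_le_rconsP => [->|[u /IHr uv uw]]; first exact: ball_center.
by apply/dist_leS; right; exists u; rewrite // adj_sym.
Qed.

Lemma house_chain_connected k : connected_graph (house_chain k).
Proof.
split; first exact: (inhabits 0%N).
move=> v w; have [vw|/ltnW wv] := leqP v w.
  by exists (w - v)%N; have := dist_add v (w - v); rewrite subnKC.
by exists (v - w)%N; apply: dist_le_sym; have := dist_add w (v - w); rewrite subnKC.
Qed.

Lemma house_chain_degree k D : (3 <= D)%N -> max_degree_le D (house_chain k).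
Proof.
move=> D3 n.
(* Three candidates cover all neighbours: successor, predecessor, and the single chord end that the
   colour allows. The final [n - 3] matters for colour [k.+4]. *)
pose g i := if i == 0%N then n.+1 else if i == 1%N then n.-1 else
  if color k n == k then n.+2 else if color k n == k.+1 then n.+3 else
  if color k n == k.+2 then n.-2 else (n - 3)%N.
apply: (@card_le_trans _ _ _ (g @` `I_3)); last first.
  apply: card_le_trans (card_image_le _ _) _.
  by apply: subset_card_le => i /= i3; exact: leq_trans D3.
apply: subset_card_le => m /= /house_adj_color.
case=> [[-> _]|[[nm _]|nm]]; [by exists 0%N | by exists 1%N; rewrite // /g nm|].
by exists 2%N => //; rewrite /g /=; do ! case: eqP; lia.
Qed.

Lemma house_chain_Gle_inf k D : (3 <= D)%N -> Gle_inf D (house_chain k).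
Proof.
move=> D3; split; last exact: infinite_nat.
by split; [exact: house_chain_connected | exact: house_chain_degree].
Qed.

Lemma iso_chart (G H : graph) : graph_iso G H ->
  exists psi : G -> H, forall r v, chart r v psi.
Proof.
move=> [f [[g fg gf] fA]]; exists f => r v; split=> [x y _ _|x y _ _|s x h _ _ xh].
- exact: (can_inj fg).
- exact: fA.
- by exists (g h); [rewrite -fA gf | exact: gf].
Qed.

(** Vertex [k] of the first chain lies on a triangle within distance [k] of the leaf. If [k < l],
    the vertices that near the leaf in the second chain are on the tail, away from triangles. *)
Lemma house_chain_iso_le k l : (0 < k)%N -> (0 < l)%N ->
  graph_iso (house_chain k) (house_chain l) -> (l <= k)%N.
Proof.
move=> k0 l0 /iso_chart[psi ch]; rewrite leqNgt; apply/negP => kl.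
have transfer p : sat p (fun=> k : house_chain k) -> sat p (psi \o (fun=> k)).
  by apply: (@chart_sat (rank p) _ _ _ psi p 0 (fun=> k) (ch _ k) _ _).1 => // ?;
     exact: ball_center.
have /transfer/sat_triangle : sat (G := house_chain k) FTriangle (fun=> k).
  by apply/sat_triangle; rewrite /color ltnn subnn; lia.
have /transfer/(sat_near l0 _ kl) : sat (G := house_chain k) (FNear k) (fun=> k).
  exact: sat_near_le.
by have := color_tail l (psi k) => /=; lia.
Qed.

Lemma house_chain_iso_eq k l : (0 < k)%N -> (0 < l)%N ->
  graph_iso (house_chain k) (house_chain l) -> k = l.
Proof.
move=> k0 l0 kl; apply/eqP; rewrite eqn_leq (house_chain_iso_le k0 l0 kl).
by rewrite (house_chain_iso_le l0 k0 (graph_iso_sym kl)).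
Qed.

(** * Strong isolation *)

Section Distance.
Variable R : realType.
Implicit Types G H : graph.
Local Open Scope ring_scope.

(** The right-hand side mentions neither [G] nor [v], so any two nonempty graphs agree at radius
    0. *)
Lemma rball0_class G (v : G) :
  rgraph_iso_class (rball 0 v) = [set B : rgraph | forall x : B, x = root B].
Proof.
have v0 (x : rball 0 v) : x = root (rball 0 v).
  by case: x => x xv; apply: eq_exist; exact/dist_le0.
apply/seteqP; split=> B.
  by move=> [f [[g fg gf] _ fr]] x; rewrite -fr -[LHS]gf; congr f; exact: v0.
move=> B0; exists (fun=> root B); split=> //.
  by exists (fun=> root (rball 0 v)) => x; [exact/esym/v0 | exact/esym/B0].
by move=> x y; rewrite (v0 x) (v0 y) !adj_irr.
Qed.

Lemma rballs0 G H : inhabited G -> inhabited H -> rballs 0 G = rballs 0 H.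
Proof.
move=> [v] [h]; apply/seteqP; split=> _ [x _ <-].
  by exists h => //; rewrite !rball0_class.
by exists v => //; rewrite !rball0_class.
Qed.

Lemma gdist_le G H r : rballs r G = rballs r H -> gdist R G H <= 2 ^- r.
Proof.
move=> GH; apply: ge_inf; last by exists r.
by exists 0 => _ [s _ <-]; rewrite invr_ge0 exprn_ge0.
Qed.

Lemma gdist_le_rballs G H r : inhabited G -> inhabited H ->
  gdist R G H <= 2 ^- r -> exists2 s : nat, (r <= s)%N & rballs s G = rballs s H.
Proof.
move=> G0 H0 d.
(* The bound [2 * 2 ^- r] lies strictly above the infimum, so some [2 ^- s] is below it; as
   exponents are integers, [s] is at least [r]. *)
have [||_ [s GHs <-] lts] := @inf_lt R
    [set 2 ^- r | r in [set r : nat | rballs r G = rballs r H]] (2 * 2 ^- r).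
- by exists (2 ^- 0), 0%N => //; exact: rballs0.
- by apply: le_lt_trans d _; rewrite ltr_pMl ?ltr1n // invr_gt0 exprn_gt0.
exists s => //; rewrite leqNgt; apply/negP => sr; move: lts; apply/negP; rewrite -leNgt.
rewrite -ler_pdivlMl // -invfM -exprS lef_pV2 ?posrE ?exprn_gt0 //.
by rewrite ler_weXn2l // ler1n.
Qed.

Lemma exp2_inv_le (eps : R) : 0 < eps -> exists r : nat, 2 ^- r <= eps.
Proof.
move=> e0; exists (Num.bound eps^-1); rewrite -[leRHS]invrK lef_pV2 ?posrE ?exprn_gt0 ?invr_gt0 //.
apply: (le_trans (ltW (archi_boundP _))); first by rewrite invr_ge0 ltW.
by rewrite -natrX ler_nat ltnW // ltn_expl.
Qed.

(** The general [X] serves both [Gle D] and [Gle_inf D]. *)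
Lemma house_chain_isolated k D (X : set graph) : (0 < k)%N -> X `<=` Gle D ->
  X (house_chain k) -> strongly_isolated R X (house_chain k).
Proof.
move=> k0 XD Xk; split=> //; exists (2 ^- (k + 8)).
  by rewrite invr_gt0 exprn_gt0.
move=> [H [/XD[Hc _] nGH]] /gdist_le_rballs[||s ks GH]; [exact: (inhabits 0%N)|exact: Hc.1|].
by apply: nGH; exact: house_chain_rigid ks Hc GH.
Qed.

Definition ball_isolated (X : set graph) (r : nat) : set graph :=
  [set G | X G /\ forall H, X H -> rballs r G = rballs r H -> graph_iso G H].

Lemma strongly_isolated_ball (X : set graph) :
  strongly_isolated R X `<=` \bigcup_r ball_isolated X r.
Proof.
move=> G [XG [eps e0 iso]]; have [r re] := exp2_inv_le e0.
exists r => //; split=> // H XH GH; apply: contrapT => nGH; apply: iso.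
by exists H; split=> //; exact: le_trans (gdist_le GH) re.
Qed.

End Distance.

(** * Countability *)

(** Elements of [K] are addresses: stop, or choose one of [D] neighbours and continue from there.
    [K] depends only on [D] and [r], which is what bounds the balls of all graphs at once. *)
Lemma ball_cover D r : exists K : finType, forall (G : graph) (v : G),
  max_degree_le D G -> exists s : K -> G, forall w, dist_le r v w -> exists i, s i = w.
Proof.
elim: r => [|r [K IHK]].
  by exists unit => G v _; exists (fun=> v) => w /dist_le0 ->; exists tt.
exists (option ('I_D * K)%type) => G v GD.
have [e eP] : exists e : 'I_D -> G, forall w, adj v w -> exists i, e i = w.
  (* [g] injects the neighbours of [v] into indices below [D]; [e] inverts it, with default [v] on
     indices that are not hit. *)
  have /pcard_leP[g] := GD v.
  exists (fun i : 'I_D => if pselect (exists2 w, adj v w & g w = i :> nat) is left p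
            then sval (cid2 p) else v) => w vw.
  have gD : (g w < D)%N by exact: (@funS _ _ _ _ g w vw).
  exists (Ordinal gD); case: pselect => [p|]; last by case; exists w.
  case: cid2 => w' vw' /= gw'; by apply: (@inj _ _ _ g); rewrite ?inE.
have /choice[s sP] := fun i => IHK G (e i) GD.
exists (fun o => if o is Some (i, j) then s i j else v) => w.
case/dist_leS => [->|[u /eP[i <-] /sP[j <-]]]; first by exists None.
by exists (Some (i, j)).
Qed.

(** The code records the vertex set, edge set and root of the copy of [B] inside [K], so codes range
    over a finite type. *)
Definition code_of (K : finType) (B : rgraph) (f : B -> K)
    (c : {set K} * {set K * K} * K) : Prop :=
  [/\ injective f, forall i, (i \in c.1.1) <-> (exists x, f x = i),
      forall x y, adj x y = ((f x, f y) \in c.1.2) & f (root B) = c.2].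

Lemma code_of_iso K (B C : rgraph) f g c :
  @code_of K B f c -> @code_of K C g c -> rgraph_iso B C.
Proof.
move=> [fi fV fE fr] [gi gV gE gr].
have /choice[h hP] : forall x, exists y, g y = f x by move=> x; apply/gV/fV; exists x.
have /choice[h' hP'] : forall y, exists x, f x = g y by move=> y; apply/fV/gV; exists y.
exists h; split.
- by exists h' => x; [apply: fi; rewrite hP' hP | apply: gi; rewrite hP hP'].
- by move=> x y; rewrite gE fE !hP.
- by apply: gi; rewrite hP gr.
Qed.

Lemma iso_code_of K (B C : rgraph) f c :
  @code_of K B f c -> rgraph_iso B C -> exists g, @code_of K C g c.
Proof.
move=> [fi fV fE fr] [h [[g hg gh] hA hr]]; exists (f \o g); split.
- exact: inj_comp fi (can_inj gh).
- move=> i; rewrite fV; split=> -[x <-]; last by exists (g x).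
  by exists (h x); rewrite /= hg.
- by move=> x y; rewrite /= -fE -hA !gh.
- by rewrite /= -hr hg.
Qed.

Lemma code_exists (K : finType) (B : rgraph) (f : B -> K) :
  injective f -> exists c, code_of f c.
Proof.
move=> fi; exists ([set i | `[< exists x, f x = i >]],
  [set p | `[< exists x y, adj x y /\ (f x, f y) = p >]], f (root B))%SET.
split=> //= [i|x y]; rewrite inE; first exact: (iff_sym (rwP (asboolP _))).
by apply/idP/asboolP => [xy|[x' [y' [xy [/fi ex /fi ey]]]]]; [exists x, y | rewrite -ex -ey].
Qed.

(** Each class consists of all rooted graphs having some fixed code. The embedding into [K] picks an
    address for each vertex of the ball. *)
Lemma finite_ball_classes D r : finite_set
  [set C | exists (G : graph) (v : G),
     max_degree_le D G /\ C = rgraph_iso_class (rball r v)].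
Proof.
have [K KP] := ball_cover D r.
apply: (@sub_finite_set _ _
  ((fun c => [set B | exists f, @code_of K B f c]) @` setT)); last first.
  exact/finite_image/finite_finset.
move=> _ [G [v [/KP-/(_ v)[s sP] ->]]].
have /choice[f fP] : forall x : rball r v, exists i, s i = sval x by case=> x xr; exact: sP.
have [|c cP] := @code_exists K (rball r v) f.
  by move=> x y xy; apply: eq_sig_hprop => [?|]; [exact: Prop_irrelevance | rewrite -!fP xy].
exists c => //; apply/seteqP; split=> B; first by case=> g gP; exact: code_of_iso cP gP.
exact: (iso_code_of cP).
Qed.

Lemma countable_ball_isolated D (X : set graph) r : X `<=` Gle D ->
  countable (iso_class @` ball_isolated X r).
Proof.
move=> XD; pose F := [set C | exists (G : graph) (v : G),
     max_degree_le D G /\ C = rgraph_iso_class (rball r v)].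
have Ff : finite_set F := finite_ball_classes D r.
(* [g] decodes a set of balls. On the set of balls of an isolated graph it returns a single
   isomorphism class, since all isolated graphs with these balls are isomorphic. *)
pose g S : set graph := [set H | exists2 G, ball_isolated X r G /\ rballs r G = S & graph_iso G H].
apply: (@sub_countable _ _ _ (g @` [set S | S `<=` F /\ finite_set S])); last first.
  by apply: card_le_trans (card_image_le _ _) _; exact/countable_finite_subset/finite_set_countable.
apply: subset_card_le => _ [G [XG isoG] <-].
have GF : rballs r G `<=` F by move=> _ [v _ <-]; exists G, v; split=> //; exact: (XD _ XG).2.
exists (rballs r G); first by split=> //; exact: sub_finite_set GF Ff.
apply/seteqP; split=> H; last by move=> GH; exists G.
by move=> [G' [[XG' isoG'] e]]; apply: graph_iso_trans; exact: isoG.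
Qed.

Lemma countable_strongly_isolated (R : realType) D (X : set graph) : X `<=` Gle D ->
  countable (iso_class @` strongly_isolated R X).
Proof.
move=> XD; apply: (@sub_countable _ _ _ (\bigcup_r iso_class @` ball_isolated X r)).
  by rewrite -image_bigcup; apply/subset_card_le/image_subset/strongly_isolated_ball.
by apply: bigcup_countable => // r _; exact: countable_ball_isolated XD.
Qed.

Lemma infinite_house_classes (P : set graph) :
  (forall k, P (house_chain k.+1)) -> infinite_set (iso_class @` P).
Proof.
(* The index is shifted because chains are told apart for positive tail length. *)
move=> Pk; apply: (@sub_infinite_set _ ((fun k => iso_class (house_chain k.+1)) @` setT)).
  by move=> _ [k _ <-]; exists (house_chain k.+1).
have inj : {in setT &, injective (fun k => iso_class (house_chain k.+1))}.
  by move=> k l _ _ /iso_classP/house_chain_iso_eq => /(_ isT isT)[].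
by apply/infiniteP; have := inj_card_eq inj; rewrite card_eq_le => /andP[].
Qed.

Theorem theorem4p15 (R : realType) (D : nat) : (3 <= D)%N ->
  [/\ countably_infinite_up_to_iso
        (strongly_isolated R (Gle D) `&` infinite_graph),
      strongly_isolated R (Gle D) `&` infinite_graph
        `<=` strongly_isolated R (Gle_inf D)
    & countably_infinite_up_to_iso (strongly_isolated R (Gle_inf D))].
Proof.
move=> D3; have infD : Gle_inf D `<=` Gle D by move=> G [].
have DD : Gle D `<=` Gle D by [].
split.
- apply: eq_card_nat.
    apply: sub_countable (countable_strongly_isolated R DD).
    by apply/subset_card_le/image_subset => G [].
  apply: infinite_house_classes => k.
  have [Gk ik] := house_chain_Gle_inf k.+1 D3; split=> //.
  exact: (house_chain_isolated R (ltn0Sn k) DD Gk).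
- move=> G [[XG [eps e0 iso]] Gi]; split=> //; exists eps => // -[H [[XH _] nGH d]].
  by apply: iso; exists H.
- apply: eq_card_nat; first exact: countable_strongly_isolated infD.
  apply: infinite_house_classes => k.
  exact: (house_chain_isolated R (ltn0Sn k) infD (house_chain_Gle_inf k.+1 D3)).
Qed.
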